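(* Let $\Omega$ be an open subset of $\bigwedge^p V$. Let $G:\Omega\to\bigwedge^q V$ and $F:\bigwedge^q V\to\bigwedge^r V$ be two functions such that $G$ is differentiable at $X_0\in\Omega$ and $F$ is differentiable at $G(X_0)\in\bigwedge^q V$. Denote by $g_{X_0}$ and $f_{G(X_0)}$ the differentials of $G$ at $X_0$ and of $F$ at $G(X_0)$, respectively. Then the composition $F\circ G:\Omega\to\bigwedge^r V$, $(F\circ G)(X)=F(G(X))$, is differentiable at $X_0$, and the differential of $F\circ G$ at $X_0$ is $f_{G(X_0)}\circ g_{X_0}$.
   Context: $V$ is a finite-dimensional real vector space of dimension $n$ with a fixed Euclidean (positive definite) scalar product; $\bigwedge V=\bigoplus_{k=0}^n\bigwedge^k V$ is the space of multivectors, with $\bigwedge^0V=\mathbb{R}$, and $p,q,r\in\{0,\dots,n\}$. The scalar product extends to multivectors by $(v_1\wedge\dots\wedge v_k)\cdot(w_1\wedge\dots\wedge w_k)=\det(v_i\cdot w_j)$, $\alpha\cdot\beta=\alpha\beta$ for scalars, with different grades orthogonal; the norm is $\|X\|=\sqrt{X\cdot X}$. Limits are with respect to $\|\cdot\|$, and open subsets of $\bigwedge^pV$ are those all of whose points are interior with respect to $\|\cdot\|$ restricted to $\bigwedge^p V$. A $(p,q)$-extensor is a linear map $\bigwedge^p V\to\bigwedge^q V$. A function $F:\Omega\to\bigwedge^q V$ with $\Omega\subseteq\bigwedge^pV$ is differentiable at $X_0\in\Omega$ if there is a $(p,q)$-extensor $f_{X_0}$ with $$\lim_{X\to X_0}\frac{F(X)-F(X_0)-f_{X_0}(X-X_0)}{\|X-X_0\|}=0;$$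 it is (for $\Omega$ open) unique and called the differential of $F$ at $X_0$. *)

(* Defs.v *)
From HB Require Import structures.
From mathcomp Require Import all_boot all_order all_algebra all_fingroup.
From mathcomp Require Import lra.
From mathcomp Require Import all_classical all_reals all_analysis.

Set Implicit Arguments.
Unset Strict Implicit.
Unset Printing Implicit Defensive.

Import Order.TTheory GRing.Theory Num.Theory.
Import numFieldNormedType.Exports.

Local Open Scope ring_scope.

Definition increasing n k (I : {ffun 'I_k -> 'I_n}) : bool :=
  [forall a : 'I_k, forall b : 'I_k, (a < b)%N ==> (I a < I b)%N].

Definition mindex n k : Type := {I : {ffun 'I_k -> 'I_n} | increasing I}.

HB.instance Definition _ n k := Finite.on (mindex n k).

Definition mindex_fun n k (I : mindex n k) : 'I_k -> 'I_n := val I.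
Coercion mindex_fun : mindex >-> Funclass.

Section Minors.

Lemma mindexP n k (I J : mindex n k) : I =1 J <-> I = J.
Proof. by split=> [eIJ|->//]; apply/val_inj/ffunP. Qed.

Lemma mindex_lt n k (I : mindex n k) (a b : 'I_k) : (a < b)%N -> (I a < I b)%N.
Proof.
by move=> lt_ab; have /forallP/(_ a)/forallP/(_ b)/implyP := valP I; apply.
Qed.

Lemma mindex_inj n k (I : mindex n k) : injective I.
Proof.
move=> a b eI; apply/val_inj; case: (ltngtP a b) => // /(mindex_lt I);
by rewrite eI ltnn.
Qed.

Lemma mindex_sorted n k (I : mindex n k) :
  sorted ltn [seq val (I a) | a <- enum 'I_k].
Proof.
case: k I => [|k] I; first by case E: (enum _) => [|[]].
have srt : sorted (relpre val ltn) (enum 'I_k.+1).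
  by rewrite -sorted_map val_enum_ord iota_ltn_sorted.
rewrite sorted_map; apply: sub_sorted srt => a b; exact: mindex_lt.
Qed.

Lemma mindex_codom_eq n k (I J : mindex n k) :
  (forall a, exists b, I a = J b) -> I = J.
Proof.
move=> sIJ; apply/mindexP.
pose s (K : mindex n k) := [seq val (K a) | a <- enum 'I_k].
have us K : uniq (s K).
  rewrite map_inj_uniq ?enum_uniq // => a b /val_inj; exact: mindex_inj.
have ss : {subset s I <= s J}.
  move=> _ /mapP[a _ ->]; have [b ->] := sIJ a.
  by apply: map_f; rewrite mem_enum.
have es : s I = s J.
  have [|_ eqIJ] := uniq_min_size (us I) ss; first by rewrite !size_map.
  apply: (irr_sorted_eq ltn_trans ltnn _ _ eqIJ); exact: mindex_sorted.
move=> a; apply/val_inj.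
have ns K : nth 0%N (s K) a = K a.
  by rewrite (nth_map a) ?size_enum_ord ?ltn_ord // nth_ord_enum.
by rewrite -[LHS]ns -[RHS]ns es.
Qed.

Lemma inj_mindex n k (f : {ffun 'I_k -> 'I_n}) : injectiveb f ->
  exists (K : mindex n k) (s : 'S_k), f = [ffun a => K (s a)].
Proof.
move=> /injectiveP finj; pose S := f @: finset.setT.
have cS : #|S| = k by rewrite card_imset // cardsT card_ord.
have fS a : f a \in S by apply: imset_f; rewrite inE.
pose K0 := [ffun a : 'I_k => enum_val (cast_ord (esym cS) a) : 'I_n].
have srt : sorted (relpre (val : 'I_n -> nat) ltn) (enum S).
  rewrite /enum_mem; apply: sorted_filter; first by move=> ? ? ?; apply: ltn_trans.
  by rewrite -enumT -sorted_map val_enum_ord iota_ltn_sorted.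
have K0P : increasing K0.
  apply/forallP => a; apply/forallP => b; apply/implyP => lt_ab; rewrite !ffunE.
  have x0 := f a; rewrite !(enum_val_nth x0) /=.
  apply: (sorted_ltn_nth _ x0 srt) => //; rewrite ?inE -?cardE ?cS //.
  by move=> ? ? ?; apply: ltn_trans.
pose s0 := fun a => cast_ord cS (enum_rank_in (fS a) (f a)).
have K0s a : K0 (s0 a) = f a by rewrite ffunE cast_ordK enum_rankK_in.
have s0inj : injective s0 by move=> a b eab; apply: finj; rewrite -!K0s eab.
exists (exist _ K0 K0P), (perm s0inj); apply/ffunP => a.
by rewrite ffunE permE -K0s.
Qed.

Lemma Cauchy_Binet (R : comNzRingType) n k (A : 'M[R]_(k, n)) (B : 'M[R]_(n, k)) :
  \det (A *m B) =
    \sum_(K : mindex n k) \det (colsub K A) * \det (rowsub K B).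
Proof.
pose T (f : {ffun 'I_k -> 'I_n}) :=
  (\prod_a A a (f a)) * \det (rowsub f B).
have -> : \det (A *m B) = \sum_f T f.
  under eq_bigr => f _ do rewrite /T mulr_sumr.
  rewrite exchange_big; apply: eq_bigr => /= s _.
  under eq_bigr => a _ do rewrite mxE.
  rewrite bigA_distr_bigA mulr_sumr; apply: eq_bigr => f _ /=.
  rewrite big_split mulrCA /=; congr (_ * (_ * _)).
  by apply: eq_bigr => a _; rewrite mxE.
rewrite (bigID (fun f : {ffun _} => injectiveb f)) /= [X in _ + X]big1 ?addr0; last first.
  move=> f /injectivePn[a [b neq_ab efab]].
  rewrite /T (determinant_alternate neq_ab) ?mulr0 // => c.
  by rewrite !mxE efab.
pose h (Ks : mindex n k * 'S_k) := [ffun a => Ks.1 (Ks.2 a)].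
have hinj : injective h.
  move=> [K s] [K' s'] /ffunP eh.
  have eKs a : K (s a) = K' (s' a) by have := eh a; rewrite !ffunE.
  have eK : K = K'.
    apply: mindex_codom_eq => a; exists (s' (s^-1%g a)).
    by rewrite -eKs permKV.
  rewrite -eK in eKs *; congr (_, _).
  by apply/permP => a; apply: (mindex_inj (I := K)).
have hP Ks : injectiveb (h Ks).
  apply/injectiveP => a b; rewrite !ffunE => /mindex_inj; exact: perm_inj.
transitivity (\sum_(Ks : mindex n k * 'S_k) T (h Ks)).
  transitivity (\sum_(f in h @: finset.setT) T f).
    apply: eq_bigl => f; apply/idP/imsetP => [/inj_mindex[K [s ->]]|[Ks _ ->]].
      by exists (K, s).
    exact: hP.
  rewrite big_imset /=; last by move=> x y _ _; apply: hinj.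
  by apply: eq_bigl => Ks; rewrite inE.
rewrite -(pair_bigA _ (fun K s => T (h (K, s)))) /=.
apply: eq_bigr => K _; rewrite mulr_suml; apply: eq_bigr => s _.
rewrite /T; have -> : rowsub (h (K, s)) B = row_perm s (rowsub K B).
  by apply/matrixP => a b; rewrite !mxE ffunE.
rewrite row_permE det_mulmx det_perm mulrA; congr (_ * _).
by rewrite mulrC; congr (_ * _); apply: eq_bigr => a _; rewrite mxE ffunE.
Qed.

Lemma det_mindex_delta (R : comNzRingType) n k (I J : mindex n k) :
  \det (\matrix_(a, b) (I a == J b)%:R) = (I == J)%:R :> R.
Proof.
have [<-|neqIJ] := eqVneq.
  rewrite -[RHS](@det1 R k); congr (\det _); apply/matrixP => a b; rewrite !mxE.
  by rewrite (inj_eq (@mindex_inj _ _ I)).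
have /existsP[a /forallP aP] : [exists a, forall b, I a != J b].
  rewrite -[_ _ _]negbK negb_exists; apply: contra neqIJ => /forallP sIJ.
  apply/eqP/mindex_codom_eq => a; have := sIJ a.
  by rewrite negb_forall => /existsP[b /negPn/eqP ->]; exists b.
rewrite (expand_det_row _ a) big1 // => b _.
by rewrite mxE (negPf (aP b)) mul0r.
Qed.

End Minors.

(* The k-th exterior power of V, in coordinates: with e the basis             *)
(* [vbasis {:V}] of V, X : multivector dot k stands for the sum over          *)
(* i_1 < ... < i_k of X (i_1, ..., i_k) (e_{i_1} /\ ... /\ e_{i_k}).          *)
(* [dot] does not enter the carrier: it is a parameter so that the norm it    *)
(* induces can be attached to the type. [blade] gives the exterior products   *)
(* of vectors; the lemmas [blade_span] and [mvdot_blade] determine the space  *)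
(* and its scalar product up to isometry, independently of the basis e.       *)
Definition multivector (R : realType) (V : vectType R)
    (dot : {dot V for idfun}) (k : nat) : Type :=
  {ffun mindex (\dim {:V}) k -> R^o}.

HB.instance Definition _ (R : realType) (V : vectType R)
    (dot : {dot V for idfun}) (k : nat) :=
  Vector.on (multivector dot k).

Section ScalarProduct.
Context {R : realType} {V : vectType R}.
Variable dot : {dot V for idfun}.
Local Notation n := (\dim {:V}).
Local Notation e := (vbasis {:V}).

(* v_1 /\ ... /\ v_k; its coordinates are the maximal minors of the matrix of *)
(* coordinates of the v_i.                                                    *)
Definition blade k (v : 'I_k -> V) : multivector dot k :=
  [ffun I : mindex n k => \det (\matrix_(a, b) coord e (I b) (v a)) : R^o].

(* Bilinear extension of                                                      *)
(*   (v_1 /\ ... /\ v_k) . (w_1 /\ ... /\ w_k) = det (v_i . w_j)              *)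
(* from the basis blades; the formula holds for all vectors, [mvdot_blade].   *)
Definition mvdot k (X Y : multivector dot k) : R :=
  \sum_(I : mindex n k) \sum_(J : mindex n k)
     X I * Y J * \det (\matrix_(a, b) dot (e`_(I a)) (e`_(J b))).

Definition mvnorm k (X : multivector dot k) : R := Num.sqrt (mvdot X X).

Lemma blade_basis k (I : mindex n k) :
  blade (fun a => e`_(I a)) = [ffun J => (J == I)%:R].
Proof.
apply/ffunP => J; rewrite !ffunE eq_sym -det_mindex_delta.
congr (\det _); apply/matrixP => a b; rewrite !mxE.
by rewrite coord_free ?(basis_free (vbasisP _)) // eq_sym.
Qed.

Lemma blade_span k (X : multivector dot k) :
  X = \sum_(I : mindex n k) (X I : R) *: blade (fun a => e`_(I a)).
Proof.
apply/ffunP => J; rewrite sum_ffunE (bigD1 J) //= big1 => [|I neqIJ].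
  by rewrite blade_basis !ffunE eqxx addr0 [RHS]mulr1.
by rewrite blade_basis !ffunE eq_sym (negPf neqIJ) [LHS]mulr0.
Qed.

Let dotC u v : dot u v = dot v u.
Proof. by rewrite (hermC dot) expr0 mul1r. Qed.

Let gram : 'M[R]_n := \matrix_(i, j) dot e`_i e`_j.

Let mvdotE k (X Y : multivector dot k) : mvdot X Y =
  \sum_(I : mindex n k) \sum_(J : mindex n k)
     X I * Y J * \det (mxsub I J gram).
Proof.
apply: eq_bigr => /= I _; apply: eq_bigr => /= J _; congr (_ * \det _).
by apply/matrixP => a b; rewrite !mxE.
Qed.

Let dot_suml (I : finType) (f : I -> V) v : dot (\sum_i f i) v = \sum_i dot (f i) v.
Proof. by rewrite dotC raddf_sum; apply: eq_bigr => i _; rewrite dotC. Qed.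

Lemma mvdot_blade k (v w : 'I_k -> V) :
  mvdot (blade v) (blade w) = \det (\matrix_(a, b) dot (v a) (w b)).
Proof.
pose M (u : 'I_k -> V) : 'M[R]_(k, n) := \matrix_(a, i) coord e i (u a).
have bladeE u (I : mindex n k) : blade u I = \det (colsub I (M u)).
  by rewrite ffunE; congr (\det _); apply/matrixP => a b; rewrite !mxE.
have -> : \matrix_(a, b) dot (v a) (w b) = M v *m (gram *m (M w)^T).
  apply/matrixP => a b; rewrite !mxE.
  rewrite [X in dot X _](coord_vbasis (memvf (v a))) dot_suml; apply: eq_bigr => i _.
  rewrite !mxE [X in dot _ X](coord_vbasis (memvf (w b))) raddf_sum /= mulr_sumr.
  apply: eq_bigr => j _; rewrite !mxE.
  by rewrite linearZl_LR linearZr_LR /= [in RHS](mulrC (dot _ _)).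
rewrite Cauchy_Binet mvdotE; apply: eq_bigr => /= I _.
have -> : rowsub I (gram *m (M w)^T) = rowsub I gram *m (M w)^T.
  by rewrite mul_rowsub_mx.
rewrite Cauchy_Binet mulr_sumr; apply: eq_bigr => /= J _.
rewrite !bladeE -mulrA; congr (_ * _).
rewrite mulrC; congr (\det _ * _); last first.
  by rewrite -det_tr; congr (\det _); apply/matrixP => a b; rewrite !mxE.
by apply/matrixP => a b; rewrite !mxE.
Qed.

Lemma mvdotC k (X Y : multivector dot k) : mvdot X Y = mvdot Y X.
Proof.
rewrite /mvdot exchange_big; apply: eq_bigr => /= I _; apply: eq_bigr => /= J _ /=.
rewrite (mulrC (X _)) -det_tr; congr (_ * \det _).
by apply/matrixP => a b; rewrite !mxE dotC.
Qed.

Lemma mvdotDl k (X Y Z : multivector dot k) :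
  mvdot (X + Y) Z = mvdot X Z + mvdot Y Z.
Proof.
rewrite -big_split; apply: eq_bigr => /= I _; rewrite -big_split /=.
by apply: eq_bigr => /= J _; rewrite ffunE -!mulrDl.
Qed.

Lemma mvdotZl k (c : R) (X Y : multivector dot k) :
  mvdot (c *: X) Y = c * mvdot X Y.
Proof.
rewrite mulr_sumr; apply: eq_bigr => /= I _; rewrite mulr_sumr.
by apply: eq_bigr => /= J _; rewrite ffunE -!mulrA.
Qed.

Let dot_ge0 u : 0 <= dot u u.
Proof. by have [->|/neq0_dnorm_gt0/ltW//] := eqVneq u 0; rewrite linear0r. Qed.

Let orthonormal_span (s : seq V) : exists t : seq V,
  [/\ forall i j : 'I_(size t), dot t`_i t`_j = (i == j)%:R
    & {subset s <= <<t>>%VS}].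
Proof.
elim: s => [|x s [t [ot st]]]; first by exists [::]; split => [[]|].
pose y := x - \sum_(i < size t) dot x t`_i *: t`_i.
have yt i : dot y t`_(i : 'I_(size t)) = 0.
  rewrite dotC linearB /= raddf_sum (bigD1 i) //= big1 => [|j neqji].
    by rewrite linearZr_LR /= ot eqxx mulr1 addr0 dotC subrr.
  by rewrite linearZr_LR /= ot eq_sym (negPf neqji) mulr0.
have xE : x = y + \sum_(i < size t) dot x t`_i *: t`_i by rewrite subrK.
have sumt : \sum_(i < size t) dot x t`_i *: t`_i \in <<t>>%VS.
  by apply: memv_suml => i _; rewrite memvZ // memv_span // mem_nth.
have [y0|y0] := eqVneq y 0.
  exists t; split => // z; rewrite inE => /predU1P[->|/st//].
  by rewrite xE y0 add0r.
have yy : 0 < dot y y by exact: neq0_dnorm_gt0.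
pose c := Num.sqrt (dot y y); have c0 : c != 0 by rewrite sqrtr_eq0 -ltNge.
exists (c^-1 *: y :: t); split.
  have y1 : dot (c^-1 *: y) (c^-1 *: y) = 1.
    rewrite linearZl_LR linearZr_LR /=.
    by rewrite -(sqr_sqrtr (ltW yy)) -/c expr2 mulKf ?mulVf.
  have y2 (i : 'I_(size t)) : dot (c^-1 *: y) t`_i = 0.
    by rewrite linearZl_LR /= yt mulr0.
  case=> [[|i] Hi] [[|j] Hj] //=.
  - by rewrite (y2 (Ordinal (Hj : (j < size t)%N))).
  - by rewrite dotC (y2 (Ordinal (Hi : (i < size t)%N))).
  - by rewrite (ot (Ordinal (Hi : (i < size t)%N)) (Ordinal (Hj : (j < size t)%N))).
have subt : {subset <<t>>%VS <= <<c^-1 *: y :: t>>%VS}.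
  by apply/subvP; apply: sub_span => u ut; rewrite inE ut orbT.
move=> z; rewrite inE => /predU1P[->|/st/subt//].
rewrite xE rpredD ?(subt _ sumt) //.
rewrite -[y in y \in _]scale1r -(divff c0) -scalerA memvZ //.
by apply: memv_span; rewrite inE eqxx.
Qed.

Let gram_factor : exists m (A : 'M[R]_(n, m)) (B : 'M[R]_(m, n)),
  gram = A *m A^T /\ A *m B = 1%:M.
Proof.
have [t [ot st]] := orthonormal_span e.
pose A : 'M[R]_(n, size t) := \matrix_(i, j) dot e`_i t`_j.
have eE (i : 'I_n) : e`_i = \sum_j A i j *: t`_j.
  have /st : e`_i \in (e : seq V) by rewrite mem_nth ?size_tuple.
  rewrite -[t]/(tval (in_tuple t)) => /coord_span eE.
  rewrite [LHS]eE; apply: eq_bigr => j _; congr (_ *: _).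
  rewrite mxE [X in dot X _]eE dot_suml (bigD1 j) //= big1 => [|l neqlj].
    by rewrite linearZl_LR /= ot eqxx mulr1 addr0.
  by rewrite linearZl_LR /= ot (negPf neqlj) mulr0.
have gE : gram = A *m A^T.
  apply/matrixP => i j; rewrite !mxE [X in dot _ X]eE raddf_sum /=.
  by apply: eq_bigr => l _; rewrite linearZr_LR /= !mxE mulrC.
have gU : gram \in unitmx.
  rewrite -row_free_unit -kermx_eq0; apply/eqP/row_matrixP => i; rewrite row0.
  set u := row i _; have ug : u *m gram = 0.
    by apply/sub_kermxP; rewrite row_sub.
  pose x := \sum_j u 0 j *: e`_j.
  have xx : dot x x = (u *m gram *m u^T) 0 0.
    rewrite mxE {2}/x raddf_sum /=; apply: eq_bigr => j _.
    rewrite linearZr_LR /= /x dot_suml !mxE mulrC; congr (_ * _).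
    by apply: eq_bigr => l _; rewrite linearZl_LR !mxE.
  have x0 : x = 0.
    apply/eqP; apply: contraT => x0.
    by have := neq0_dnorm_gt0 (s := dot) x x0; rewrite xx ug mul0mx mxE ltxx.
  have /freeP/(_ (u 0)) u0 := basis_free (vbasisP {:V}).
  by apply/rowP => j; rewrite u0 // mxE.
exists (size t), A, (A^T *m invmx gram); split => //.
by rewrite mulmxA -gE mulmxV.
Qed.

Lemma mvdot_sqr k : exists (m : nat) (C : mindex n k -> mindex m k -> R)
    (D : mindex m k -> mindex n k -> R),
  (forall X : multivector dot k,
     mvdot X X = \sum_(K : mindex m k) (\sum_(I : mindex n k) X I * C I K) ^+ 2) /\
  (forall I J, \sum_K C I K * D K J = (I == J)%:R).
Proof.
have [m [A [B [gE AB]]]] := gram_factor.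
exists m, (fun I K => \det (mxsub I K A)), (fun K J => \det (mxsub K J B)).
split=> [X|I J].
  rewrite mvdotE; under [RHS]eq_bigr => K _.
    rewrite expr2 mulr_suml; under eq_bigr do rewrite mulr_sumr.
    over.
  rewrite [RHS]exchange_big; apply: eq_bigr => /= I _ /=.
  rewrite exchange_big; apply: eq_bigr => /= J _ /=.
  have -> : mxsub I J gram = rowsub I A *m (rowsub J A)^T.
    by rewrite gE; apply/matrixP => a b; rewrite !mxE; apply: eq_bigr => c _; rewrite !mxE.
  rewrite Cauchy_Binet mulr_sumr; apply: eq_bigr => /= K _.
  rewrite [RHS]mulrACA; congr (_ * (\det _ * _)).
    by apply/matrixP => a b; rewrite !mxE.
  by rewrite -det_tr; congr (\det _); apply/matrixP => a b; rewrite !mxE.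
rewrite -det_mindex_delta.
have -> : \matrix_(a, b) (I a == J b)%:R = rowsub I A *m colsub J B.
  apply/matrixP => a b; rewrite mxE.
  transitivity ((A *m B) (I a) (J b)); first by rewrite AB mxE.
  by rewrite !mxE; apply: eq_bigr => c _; rewrite !mxE.
rewrite Cauchy_Binet; apply: eq_bigr => /= K _.
by congr (_ * _); congr (\det _); apply/matrixP => a b; rewrite !mxE.
Qed.

Lemma mvdot_ge0 k (X : multivector dot k) : 0 <= mvdot X X.
Proof.
have [m [C [D [-> _]]]] := mvdot_sqr k.
by apply: sumr_ge0 => K _; rewrite sqr_ge0.
Qed.

Lemma mvdot_eq0 k (X : multivector dot k) : mvdot X X = 0 -> X = 0.
Proof.
have [m [C [D [XX CD]]]] := mvdot_sqr k.
rewrite XX => /eqP; rewrite psumr_eq0 => [/allP X0|K _]; last exact: sqr_ge0.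
have {}X0 K : \sum_I X I * C I K = 0.
  by have /eqP := X0 K (mem_index_enum _); rewrite /= => /eqP; rewrite sqrf_eq0 => /eqP.
apply/ffunP => J; rewrite [RHS]ffunE.
have XE : X J = \sum_K (\sum_(I : mindex n k) (X I : R) * C I K) * D K J.
  transitivity (\sum_(I : mindex n k) \sum_K (X I : R) * (C I K * D K J)).
    rewrite (bigD1 J) //= -mulr_sumr CD eqxx mulr1 big1 ?addr0 // => I neqIJ.
    by rewrite -mulr_sumr CD (negPf neqIJ) mulr0.
  rewrite exchange_big; apply: eq_bigr => /= K _; rewrite mulr_suml.
  by apply: eq_bigr => /= I _; rewrite mulrA.
by rewrite XE big1 // => K _; rewrite X0 mul0r.
Qed.

Lemma mvnormZ k (c : R) (X : multivector dot k) :
  mvnorm (c *: X) = `|c| * mvnorm X.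
Proof.
rewrite /mvnorm mvdotZl mvdotC mvdotZl mulrA -expr2.
by rewrite sqrtrM ?sqr_ge0 // sqrtr_sqr.
Qed.

Lemma mvnorm_eq0 k (X : multivector dot k) : mvnorm X = 0 -> X = 0.
Proof.
move=> /eqP; rewrite sqrtr_eq0 => X0; apply: mvdot_eq0.
by apply/le_anti; rewrite X0 mvdot_ge0.
Qed.

Lemma mvnormD k (X Y : multivector dot k) : mvnorm (X + Y) <= mvnorm X + mvnorm Y.
Proof.
have sqn Z : mvnorm Z ^+ 2 = mvdot Z Z :> R by rewrite sqr_sqrtr ?mvdot_ge0.
have n0 Z : 0 <= mvnorm Z :> R by rewrite sqrtr_ge0.
have CS : mvdot X Y <= mvnorm X * mvnorm Y.
  have [X0|X0] := eqVneq (mvnorm X) 0.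
    by rewrite X0 mul0r (mvnorm_eq0 X0) -(scale0r X) mvdotZl mul0r.
  have [Y0|Y0] := eqVneq (mvnorm Y) 0.
    by rewrite Y0 mulr0 (mvnorm_eq0 Y0) mvdotC -(scale0r X) mvdotZl mul0r.
  set a := mvnorm X in X0 *; set b := mvnorm Y in Y0 *.
  have ab : 0 < a * b by rewrite mulr_gt0 // lt0r ?X0 ?Y0 n0.
  rewrite -(ler_pM2l ab).
  have := mvdot_ge0 (b *: X + (- a) *: Y).
  rewrite mvdotDl !(mvdotC _ (_ + _)) !mvdotDl !mvdotZl.
  rewrite !(mvdotC _ (_ *: _)) !mvdotZl (mvdotC Y X) -!sqn -/a -/b.
  set d := mvdot X Y; move=> H.
  nra.
rewrite -(ler_pXn2r (_ : 0 < 2)%N) ?nnegrE ?addr_ge0 //.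
rewrite sqn mvdotDl !(mvdotC _ (_ + _)) !mvdotDl (mvdotC Y X) -!sqn.
nra.
Qed.

End ScalarProduct.

(* From here on `|X| is [mvnorm X], and neighborhoods, open sets and limits   *)
(* in [multivector dot k] are those of this norm.                             *)
HB.instance Definition _ (R : realType) (V : vectType R)
    (dot : {dot V for idfun}) (k : nat) :=
  Lmodule_isNormed.Build R (multivector dot k)
    (@mvnormD R V dot k) (@mvnormZ R V dot k) (@mvnorm_eq0 R V dot k).

Section Differential.
Local Open Scope classical_set_scope.
Context {R : realType} {V : vectType R} {dot : {dot V for idfun}} {p q : nat}.

Definition extensor := 'Hom(multivector dot p, multivector dot q).

Implicit Types (Omega : set (multivector dot p)) (X Y : multivector dot p).
Implicit Types (F : multivector dot p -> multivector dot q) (f : extensor).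

(* A function defined on Omega is represented by a total function; its values *)
(* outside Omega are irrelevant, as the limit is taken along X in Omega,      *)
(* X != X0.                                                                   *)
Definition is_differential Omega F (X0 : multivector dot p) f : Prop :=
  (fun X => `|X - X0|^-1 *: (F X - F X0 - f (X - X0)))
    @ within Omega X0^' --> (0 : multivector dot q).

Definition differentiable_on Omega F (X0 : multivector dot p) : Prop :=
  exists f, is_differential Omega F X0 f.

(* Meaningful when F is differentiable at X0, with default value 0 otherwise; *)
(* for open Omega the choice is unique by [is_differential_unique].           *)
Definition differential Omega F (X0 : multivector dot p) : extensor :=
  xget (0 : extensor) [set f | is_differential Omega F X0 f].

Lemma is_differential_unique Omega F (X0 : multivector dot p) f g :
  open Omega -> Omega X0 ->
  is_differential Omega F X0 f -> is_differential Omega F X0 g -> f = g.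
Proof.
move=> oO OX0 Ff Fg; apply/lfunP => H; apply/eqP; rewrite -subr_eq0 -normr_eq0.
rewrite eq_le normr_ge0 andbT; apply/ler_addgt0Pr => eps eps0; rewrite add0r.
have [->|H0] := eqVneq H 0; first by rewrite linear0 linear0 subrr normr0 ltW.
have nH : 0 < `|H| by rewrite normr_gt0.
have e0 : 0 < eps / `|H| by rewrite divr_gt0.
have FF : Filter (within Omega X0^') by exact: within_filter.
have D0 := cvgB (FF := FF) Fg Ff; rewrite subrr in D0.
have := cvgr0_norm_lt (FF := FF) _ D0 _ e0.
rewrite !near_withinE near_nbhs => /nbhs_ballP[d /= d0 dP].
have /nbhs_ballP[d' /= d'0 d'P] : nbhs X0 Omega by apply: open_nbhs_nbhs.
pose m := Num.min d d'; have m0 : 0 < m by rewrite lt_min d0.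
pose t := m / (2 * `|H|).
have t0 : 0 < t by rewrite divr_gt0 ?mulr_gt0.
pose X := X0 + t *: H.
have XX0 : X - X0 = t *: H by rewrite /X addrAC subrr add0r.
have nX : `|X - X0| = t * `|H| by rewrite XX0 normrZ gtr0_norm.
have nXm : `|X0 - X| < m.
  rewrite distrC nX /t invfM mulrA mulfVK ?gt_eqF //.
  by rewrite ltr_pdivrMr // ltr_pMr // ltr1n.
have OX : Omega X.
  by apply: d'P; rewrite -ball_normE /=; apply: lt_le_trans nXm _; rewrite ge_min lexx orbT.
have := dP X; rewrite -ball_normE /= => /(_ _ _ OX).
have nXd : `|X0 - X| < d by apply: lt_le_trans nXm _; rewrite ge_min lexx.
have neX : X != X0 by rewrite -subr_eq0 -normr_eq0 nX mulf_neq0 ?gt_eqF.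
move=> /(_ nXd neX).
rewrite !fctE -scalerBr; set D := F X - F X0.
have -> : D - g (X - X0) - (D - f (X - X0)) = t *: (f H - g H).
  by rewrite opprB addrC addrA subrK XX0 scalerBr !linearZ.
rewrite normrZ normfV normr_id nX normrZ (gtr0_norm t0) invfM mulrACA mulVf ?gt_eqF // mul1r.
by rewrite mulrC ltr_pM2r ?invr_gt0 // => /ltW.
Qed.

End Differential.

Arguments extensor {R V} dot p q.

(* Main.v *)
Require Import Defs.
From mathcomp Require Import all_boot all_order all_algebra.
From mathcomp Require Import all_classical all_reals all_analysis.
Import Order.TTheory GRing.Theory Num.Theory.
Import numFieldNormedType.Exports.

(** Differentiability at [X0] says that for every [eps > 0] the remainder
    [F X - F X0 - f (X - X0)] is at most [eps * `|X - X0|] near [X0].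
    The remainder of [F \o G] is the remainder of [F] at [G X0], taken at [G X],
    plus the image under [f] of the remainder of [G]; since extensors are
    bounded, [`|G X - G X0|] is [O(`|X - X0|)] and both terms are
    [o(`|X - X0|)]. *)

Local Open Scope ring_scope.
Local Open Scope classical_set_scope.

Section Bounded.
Set Implicit Arguments.
Unset Strict Implicit.
Context (R : realType) (V : vectType R) (dot : {dot V for idfun}).

(** By [mvdot_sqr], [mvdot X X] is a sum of squares of linear forms with coefficients [C]. Since [D]
    inverts [C] on the right, each coordinate is a fixed combination of these forms, and each form
    is at most [|X|] in absolute value. *)
Lemma mvcoord_bounded k (J : mindex (\dim {:V}) k) :
  exists2 C : R, 0 <= C & forall X : multivector dot k, `|X J : R| <= C * `|X|.
Proof.
have [m [C [D [XX CD]]]] := mvdot_sqr dot k.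
exists (\sum_K `|D K J|) => [|X]; first exact: sumr_ge0.
have -> : X J = \sum_K (\sum_(I : mindex _ k) (X I : R) * C I K) * D K J.
  transitivity (\sum_(I : mindex _ k) \sum_K (X I : R) * (C I K * D K J)).
    rewrite (bigD1 J) //= -mulr_sumr CD eqxx mulr1 big1 ?addr0 // => I neqIJ.
    by rewrite -mulr_sumr CD (negPf neqIJ) mulr0.
  rewrite exchange_big; apply: eq_bigr => /= K _; rewrite mulr_suml.
  by apply: eq_bigr => /= I _; rewrite mulrA.
rewrite mulr_suml; apply: le_trans (ler_norm_sum _ _ _) _.
apply: ler_sum => K _; rewrite normrM mulrC ler_wpM2l //.
(* A single square is at most the whole sum of squares; take square roots. *)
rewrite -sqrtr_sqr [leRHS]/(Num.sqrt (mvdot X X)) ler_wsqrtr // XX (bigD1 K) //=.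
by rewrite lerDl sumr_ge0 // => *; rewrite sqr_ge0.
Qed.

(** Expand [X] in the basis blades: the coordinates are bounded by multiples of [|X|], and only
    finitely many images [f (b I)] occur. *)
Lemma extensor_bounded p q (f : extensor dot p q) :
  exists2 C : R, 0 <= C & forall X, `|f X| <= C * `|X|.
Proof.
have /choice[c cP] : forall J : mindex (\dim {:V}) p, exists c : R,
    0 <= c /\ forall X : multivector dot p, `|X J : R| <= c * `|X|.
  by move=> J; have [c c0 cX] := mvcoord_bounded J; exists c.
pose b (I : mindex (\dim {:V}) p) : multivector dot p :=
  blade dot (fun a => (vbasis {:V})`_(I a)).
exists (\sum_I c I * `|f (b I)|) => [|X].
  by apply: sumr_ge0 => I _; rewrite mulr_ge0 //; have [] := cP I.
rewrite {1}(blade_span X) linear_sum mulr_suml.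
apply: le_trans (ler_norm_sum _ _ _) _; apply: ler_sum => I _.
rewrite linearZ normrZ mulrAC ler_wpM2r //; exact: (cP I).2.
Qed.

End Bounded.

Section ChainRule.
Set Implicit Arguments.
Unset Strict Implicit.
Context {R : realType} {V : vectType R} {dot : {dot V for idfun}}.

(** Clearing the denominator also lets [X = X0] back in, where both sides vanish, so the punctured
    neighborhood becomes a full one. *)
Lemma is_differentialP p q (Omega : set (multivector dot p))
    (F : multivector dot p -> multivector dot q) X0 (f : extensor dot p q) :
  is_differential Omega F X0 f <->
  forall eps : R, 0 < eps -> \forall X \near X0, Omega X ->
    `|F X - F X0 - f (X - X0)| <= eps * `|X - X0|.
Proof.
have FF : Filter (within Omega X0^') by exact: within_filter.
split=> [fF eps eps0|fF].
  have := cvgr0_norm_le (FF := FF) _ fF _ eps0.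
  rewrite !near_withinE; apply: filterS => X XP OX.
  have [->|XX0] := eqVneq X X0; first by rewrite !subrr linear0 subr0 !normr0 mulr0.
  have nX : 0 < `|X - X0| by rewrite normr_gt0 subr_eq0.
  have := XP XX0 OX.
  by rewrite normrZ normfV normr_id ler_pdivrMl // mulrC.
apply/(cvgr0Pnorm_le (FF := FF)) => eps eps0.
rewrite !near_withinE; apply: filterS (fF eps eps0) => X XP XX0 OX.
have nX : 0 < `|X - X0| by rewrite normr_gt0 subr_eq0.
by rewrite normrZ normfV normr_id ler_pdivrMl // mulrC; exact: XP.
Qed.

(** The value chosen by [xget] is some differential, and on an open set there is only one. *)
Lemma differentialE p q (Omega : set (multivector dot p))
    (F : multivector dot p -> multivector dot q) X0 (f : extensor dot p q) :
  open Omega -> Omega X0 -> is_differential Omega F X0 f ->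
  differential Omega F X0 = f.
Proof.
move=> oO OX0 fF; apply: (is_differential_unique oO OX0 _ fF).
by have /(xgetPex 0) := ex_intro (is_differential Omega F X0) f fF.
Qed.

Lemma is_differential_comp p q r (Omega : set (multivector dot p))
    (G : multivector dot p -> multivector dot q)
    (F : multivector dot q -> multivector dot r) X0
    (g : extensor dot p q) (f : extensor dot q r) :
  is_differential Omega G X0 g -> is_differential setT F (G X0) f ->
  is_differential Omega (F \o G) X0 (f \o g)%VF.
Proof.
move=> /is_differentialP gG /is_differentialP fF.
apply/is_differentialP => eps eps0.
have [A A0 gA] := extensor_bounded g.
have [B B0 fB] := extensor_bounded f.
have A1 : 0 < A + 1 by rewrite ltr_wpDl.
(* [B] may be zero; [B + 1] can safely be divided by. *)
have B1 : 0 < B + 1 by rewrite ltr_wpDl.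
have e2 : 0 < eps / 2 by rewrite divr_gt0.
(* In the constant [A + 1], [A] bounds [g] and [1] bounds the remainder of [G]. *)
have G_lip : \forall X \near X0, Omega X -> `|G X - G X0| <= (A + 1) * `|X - X0|.
  apply: filterS (gG 1 ltr01) => X XP OX.
  rewrite -[G X - G X0](subrK (g (X - X0))) mulrDl addrC.
  apply: le_trans (ler_normD _ _) _; exact: lerD (gA _) (XP OX).
(* The tolerance [eps / 2 / (A + 1)] offsets the factor [A + 1] of [G_lip]; [X_small] then keeps
   [G X] within [d] of [G X0]. *)
have /nbhs_ballP[d /= d0 dP] := fF _ (divr_gt0 e2 A1).
have X_small : \forall X \near X0, (A + 1) * `|X - X0| < d.
  apply/nbhs_ballP; exists (d / (A + 1)) => /=; first exact: divr_gt0.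
  by move=> X; rewrite -ball_normE /= distrC ltr_pdivlMr // mulrC.
near=> X => OX.
have GX : `|G X - G X0| <= (A + 1) * `|X - X0| by move: OX; near: X.
have GXd : (A + 1) * `|X - X0| < d by near: X.
have GR : `|G X - G X0 - g (X - X0)| <= eps / 2 / (B + 1) * `|X - X0|.
  by move: OX; near: X; apply: gG; rewrite divr_gt0.
have FR : `|F (G X) - F (G X0) - f (G X - G X0)| <=
    eps / 2 / (A + 1) * `|G X - G X0|.
  by apply: dP => //; rewrite -ball_normE /= distrC (le_lt_trans GX).
have -> : (F \o G) X - (F \o G) X0 - (f \o g)%VF (X - X0) =
    (F (G X) - F (G X0) - f (G X - G X0)) + f (G X - G X0 - g (X - X0)).
  by rewrite comp_lfunE [f (_ - g _)]linearB addrA subrK.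
(* Each of the two remainders receives half of [eps]. *)
rewrite [eps]splitr mulrDl; apply: le_trans (ler_normD _ _) (lerD _ _).
  apply: le_trans FR _; rewrite -mulrA ler_wpM2l ?(ltW e2) //.
  by rewrite ler_pdivrMl.
apply: le_trans (fB _) _; apply: le_trans (ler_wpM2l B0 GR) _.
(* What remains is [B / (B + 1) <= 1]. *)
rewrite mulrA ler_wpM2r // mulrCA ger_pMr // ler_pdivrMr // mul1r.
by rewrite lerDl.
Unshelve. all: by end_near. Qed.

End ChainRule.

Theorem theorem5 (R : realType) (V : vectType R) (dot : {dot V for idfun})
  (n p q r : nat) (dimV : \dim {:V} = n)
  (lepn : (p <= n)%N) (leqn : (q <= n)%N) (lern : (r <= n)%N)
  (Omega : set (multivector dot p)) (Omega_open : open Omega)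
  (G : multivector dot p -> multivector dot q)
  (F : multivector dot q -> multivector dot r)
  (X0 : multivector dot p) (X0Omega : Omega X0)
  (G_diff : differentiable_on Omega G X0)
  (F_diff : differentiable_on [set: multivector dot q] F (G X0)) :
  differentiable_on Omega (F \o G) X0 /\
  differential Omega (F \o G) X0 =
    (differential [set: multivector dot q] F (G X0) \o
       differential Omega G X0)%VF.
Proof.
have [g gG] := G_diff; have [f fF] := F_diff.
have fgFG := is_differential_comp gG fF.
split; first by exists (f \o g)%VF.
rewrite (differentialE Omega_open X0Omega gG).
rewrite (differentialE openT I fF).
exact: differentialE Omega_open X0Omega fgFG.
Qed.
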